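(* Let $G$ be a finite group and let $A$ be an $N\times N$ irreducible matrix with nonnegative integer entries such that $\sum_{i=1}^NA(i,j)\ge2$ for each $j=1,\dots,N$. For a map $\ell:\Sigma^-\cup\Sigma^+\to G$, the $G$-conjugacy class of the $G$-SFT $\Lambda_A^{G,\tau_{\ell_A}}$ is an invariant of the $G$-conjugacy class of the $G$-subshift $D_A^{G,\tau_\ell}$ of the Markov--Dyck shift $D_A$. Hence, for maps $\ell^1,\ell^2:\Sigma^-\cup\Sigma^+\to G$, if the two $G$-SFTs $\Lambda_A^{G,\tau_{\ell^1_A}}$ and $\Lambda_A^{G,\tau_{\ell^2_A}}$ are not $G$-conjugate, then the $G$-subshifts $D_A^{G,\tau_{\ell^1}}$ and $D_A^{G,\tau_{\ell^2}}$ are not $G$-conjugate.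
   Context: Skew products: for a subshift $(\Lambda,\sigma)$ and a continuous $\tau:\Lambda\to G$, $\Lambda^{G,\tau}$ is $G\times\Lambda$ with the homeomorphism $(g,x)\mapsto(g\tau(x),\sigma(x))$ and the $G$-action $\rho_g(a,x)=(ga,x)$; it is (topologically conjugate to) a subshift with a $G$-action commuting with the shift. $G$-conjugate means topologically conjugate by a conjugacy commuting with the $G$-actions. A $G$-SFT is a shift of finite type with a continuous $G$-action commuting with the shift. Markov--Dyck shift $D_A$: let $\mathcal{G}_A=(V_A,E_A)$ be the finite directed graph with $N$ vertices $v_1,\dots,v_N$ and $A(i,j)$ edges from $v_i$ to $v_j$, $E_A=\{e_1,\dots,e_{N_A}\}$. Let $A^{\mathcal{G}}$ be the $N_A\times N_A$ matrix with $A^{\mathcal{G}}(i,j)=1$ if $t(e_i)=s(e_j)$ (terminal vertex of $e_i$ equals source vertex of $e_j$) and $0$ otherwise, and let $S_1,\dots,S_{N_A}$ be the generating partial isometries of the Cuntz--Krieger algebra $\mathcal{O}_{A^{\mathcal{G}}}$: $\sum_jS_jS_j^*=1$, $S_i^*S_i=\sum_jA^{\mathcal{G}}(i,j)S_jS_j^*$. Put $\alpha_i=S_i^*$, $\beta_i=S_i$, $\Sigma^-=\{\alpha_1,\dots,\alpha_{N_A}\}$, $\Sigma^+=\{\beta_1,\dots,\beta_{N_A}\}$, regarded as $2N_A$ distinct symbols. $D_A$ is the subshift over $\Sigma^-\cup\Sigma^+$ whose forbidden words are the words $\gamma_1\cdots\gamma_n$ whose product in $\mathcal{O}_{A^{\mathcal{G}}}$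 is $0$. For $\ell:\Sigma^-\cup\Sigma^+\to G$, $\tau_\ell:D_A\to G$ is $\tau_\ell((\gamma_n)_n)=\ell(\gamma_0)$. The sequences in $D_A$ with all symbols in $\Sigma^+$ form the shift of finite type $\Lambda_A$ of biinfinite edge paths of $\mathcal{G}_A$ (identify $\beta_i$ with $e_i$), and $\tau_{\ell_A}$ denotes the restriction of $\tau_\ell$ to $\Lambda_A$. *)

(* Defs.v *)
From HB Require Import structures.
From mathcomp Require Import all_boot all_order all_fingroup all_algebra.
From mathcomp Require Import all_classical all_reals.
From mathcomp Require Import topology normedtype.
From mathcomp Require Import complex.

Set Implicit Arguments.
Unset Strict Implicit.
Unset Printing Implicit Defensive.

Import GRing.Theory Num.Theory.
Import numFieldNormedType.Exports.

Local Open Scope classical_set_scope.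
Local Open Scope ring_scope.

(** Unital complex C*-algebras, over the complex numbers [R[i]] *)

Record cstarAlgType (R : realType) := CStarAlgebra {
  cstar_sort :> algType R[i];
  star : cstar_sort -> cstar_sort;
  cnorm : cstar_sort -> R;
  starD : forall x y, star (x + y) = star x + star y;
  starZ : forall (a : R[i]) x, star (a *: x) = Num.conj a *: star x;
  starM : forall x y, star (x * y) = star y * star x;
  starK : forall x, star (star x) = x;
  cnorm_eq0 : forall x, cnorm x = 0 -> x = 0;
  cnormD : forall x y, cnorm (x + y) <= cnorm x + cnorm y;
  cnormZ : forall (a : R[i]) x,
    cnorm (a *: x) = ComplexField.Normc.normc a * cnorm x;
  cnormM : forall x y, cnorm (x * y) <= cnorm x * cnorm y;
  cnorm_starM : forall x, cnorm (star x * x) = cnorm x ^+ 2;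
  cnorm_complete : forall u : nat -> cstar_sort,
    (forall e : R, 0 < e -> exists n0, forall m n, (n0 <= m)%N -> (n0 <= n)%N ->
       cnorm (u m - u n) < e) ->
    exists l, forall e : R, 0 < e -> exists n0, forall n, (n0 <= n)%N ->
      cnorm (u n - l) < e
}.

(** No proper norm-closed *-subalgebra contains all the [S i]. *)
Definition cstar_generated (R : realType) (O : cstarAlgType R) (I : Type)
    (S : I -> O) : Prop :=
  forall B : set O,
    B 1 -> (forall i, B (S i)) ->
    (forall x y, B x -> B y -> B (x + y)) ->
    (forall x y, B x -> B y -> B (x * y)) ->
    (forall (a : R[i]) x, B x -> B (a *: x)) ->
    (forall x, B x -> B (star x)) ->
    (forall x, (forall e : R, 0 < e -> exists2 y, B y & cnorm (x - y) < e) ->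
       B x) ->
    B = setT.

(** [O] is the Cuntz-Krieger algebra of the 0-1 matrix [M], with generating
    partial isometries [S].  By the Cuntz-Krieger uniqueness theorem this
    determines [(O, S)] up to isomorphism as soon as [M] satisfies
    condition (I), in particular when [M] is irreducible and is not a
    permutation matrix. *)
Record cuntz_krieger (R : realType) (I : finType) (M : rel I)
    (O : cstarAlgType R) (S : I -> O) : Prop := CuntzKrieger {
  ck_neq0 : forall i, S i != 0;
  ck_pisom : forall i, S i * star (S i) * S i = S i;
  ck_sum1 : \sum_j S j * star (S j) = 1;
  ck_rel : forall i,
    star (S i) * S i = \sum_j (M i j)%:R * (S j * star (S j));
  ck_gen : cstar_generated S
}.

(** Subshifts over a finite alphabet, as subsets of the full shift *)

Definition full_shift (T : finType) : topologicalType :=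
  {ptws int -> discrete_topology T}.

Definition shift_map (T : finType) (x : full_shift T) : full_shift T :=
  fun n => x (n + 1).

Definition block_word (T : finType) (x : full_shift T) (k : int) (n : nat) :
    seq T :=
  [seq x (k + i%:Z) | i <- iota 0 n].

Definition subshift (T : finType) (F : set (seq T)) : set (full_shift T) :=
  [set x | forall k n, ~ F (block_word x k n)].

(** A homeomorphism [gs_dyn] of the space [gs_space], seen in an ambient
    topological space, together with an action [gs_act] of the group. *)
Record gsystem (gT : finGroupType) := GSystem {
  gs_top : topologicalType;
  gs_space : set gs_top;
  gs_dyn : gs_top -> gs_top;
  gs_act : gT -> gs_top -> gs_top
}.
Arguments gs_space {gT} _.
Arguments gs_dyn {gT} _.
Arguments gs_act {gT} _.

Definition skew_product (gT : finGroupType) (T : finType)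
    (X : set (full_shift T)) (tau : full_shift T -> gT) : gsystem gT :=
  @GSystem gT (discrete_topology gT * full_shift T)%type
    [set gx | X gx.2]
    (fun gx => ((gx.1 : gT) * tau gx.2, shift_map gx.2)%g)
    (fun g ax => (g * (ax.1 : gT), ax.2)%g).

Definition G_conjugate (gT : finGroupType) (X Y : gsystem gT) : Prop :=
  exists (f : gs_top X -> gs_top Y) (h : gs_top Y -> gs_top X),
    [/\ {within gs_space X, continuous f} /\
        {within gs_space Y, continuous h},
        set_fun (gs_space X) (gs_space Y) f /\
        set_fun (gs_space Y) (gs_space X) h,
        {in gs_space X, cancel f h} /\ {in gs_space Y, cancel h f},
        {in gs_space X, forall x, f (gs_dyn X x) = gs_dyn Y (f x)}
      & {in gs_space X, forall x, forall g, f (gs_act X g x) = gs_act Y g (f x)}].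

(** The edges of the graph of a matrix: [Tagged _ k], with
    [k : 'I_(A i j)], tagged by [(i, j)], is the k-th edge from [i] to [j]. *)

Definition edge (N : nat) (A : 'M[nat]_N) : finType :=
  {ij : 'I_N * 'I_N & 'I_(A ij.1 ij.2)}.

Definition source (N : nat) (A : 'M[nat]_N) (e : edge A) : 'I_N :=
  (tag e).1.

Definition target (N : nat) (A : 'M[nat]_N) (e : edge A) : 'I_N :=
  (tag e).2.

Definition edge_matrix (N : nat) (A : 'M[nat]_N) : rel (edge A) :=
  fun e f => target e == source f.

Definition irreducible_mx (N : nat) (A : 'M[nat]_N) : Prop :=
  forall i j, exists n, (0 < (A ^+ n.+1) i j)%N.

(** The alphabet of the Markov-Dyck shift: [inl e] is the symbol alpha_e
    and [inr e] is the symbol beta_e. *)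
Definition dyck_symbol (N : nat) (A : 'M[nat]_N) : finType :=
  (edge A + edge A)%type.

Definition symbol_val (R : realType) (N : nat) (A : 'M[nat]_N)
    (O : cstarAlgType R) (S : edge A -> O) (c : dyck_symbol A) : O :=
  match c with inl e => star (S e) | inr e => S e end.

Definition markov_dyck (R : realType) (N : nat) (A : 'M[nat]_N)
    (O : cstarAlgType R) (S : edge A -> O) : set (full_shift (dyck_symbol A)) :=
  subshift [set w | \prod_(c <- w) symbol_val S c = 0].

(** The points of [markov_dyck S] with symbols beta only: up to dropping the
    tag [inr], the biinfinite edge paths of the graph. *)
Definition markov_dyck_pos (R : realType) (N : nat) (A : 'M[nat]_N)
    (O : cstarAlgType R) (S : edge A -> O) : set (full_shift (dyck_symbol A)) :=
  [set x | markov_dyck S x /\ forall n, exists e, x n = inr e].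

Definition tau (gT : finGroupType) (T : finType) (l : T -> gT)
    (x : full_shift T) : gT :=
  l (x 0).

Definition markov_dyck_skew (R : realType) (gT : finGroupType) (N : nat)
    (A : 'M[nat]_N) (O : cstarAlgType R) (S : edge A -> O)
    (l : dyck_symbol A -> gT) : gsystem gT :=
  skew_product (markov_dyck S) (tau l).

Definition markov_dyck_pos_skew (R : realType) (gT : finGroupType) (N : nat)
    (A : 'M[nat]_N) (O : cstarAlgType R) (S : edge A -> O)
    (l : dyck_symbol A -> gT) : gsystem gT :=
  skew_product (markov_dyck_pos S) (tau l).

(* Main.v *)
(** For finite [G], a [G]-conjugacy [f] of the skew products has the form
    [f (g, x) = (g c(x), phi x)] for a topological conjugacy [phi] of the
    Markov-Dyck shifts, so it suffices that [phi] maps points with symbols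
    [beta] only to points with symbols [beta] only: then [f] itself restricts
    to the required [G]-conjugacy.

    Call [x] synchronizing with constant [C] if, for all [l], every block of [x]
    of length [l + C] makes the [l] symbols before it independent of the symbols
    after it.  Up to a change of [C], bounded in terms of the window of [phi],
    this is invariant under conjugacy.  A block with value [S_mu S_nu^*]
    synchronizes exactly about [|mu|] symbols on its left, so points without
    [alpha] are synchronizing, while a synchronizing point has a bounded number
    of [alpha]'s in all of its blocks.  A periodic synchronizing point therefore
    has no [alpha] at all, and periodic points are dense in the edge shift.

    The value of words is computed from [S_e^* S_f = 0] for [e <> f], that is
    from the orthogonality of projections [p_j] with sum [1] in a C*-algebra.
    Compressing by [p_i] gives self-adjoint [z] with [‖p_i + z‖, ‖p_i - z‖ <= 1],
    which forces [z = 0]. *)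

Require Import Defs.
From mathcomp Require Import all_boot all_order all_fingroup all_algebra.
From mathcomp Require Import all_classical all_reals.
From mathcomp Require Import topology.
From mathcomp Require Import complex ring lra zify.

Set Implicit Arguments.
Unset Strict Implicit.
Unset Printing Implicit Defensive.

Import Order.TTheory GRing.Theory Num.Theory.
Import ComplexField.Normc.

Local Open Scope ring_scope.

Local Open Scope classical_set_scope.

(** * C*-algebras *)

Section CStar.
Variables (R : realType) (O : cstarAlgType R).
Implicit Types (x y z p : O).

Lemma normc_real (r : R) : 0 <= r -> normc r%:C%C = r.
Proof. by move=> r0; rewrite /normc /= expr0n addr0 sqrtr_sqr ger0_norm. Qed.

Lemma conj_imag : Num.conj 'i%C = - 'i%C :> R[i].
Proof. by apply/eqP; rewrite eq_complex /= oppr0 !eqxx. Qed.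

Lemma imag_sqr : 'i%C * 'i%C = -1 :> R[i].
Proof. by apply/eqP; rewrite eq_complex /= !mul0r mulr0 mulr1 sub0r addr0 oppr0 !eqxx. Qed.

Lemma cnorm0 : cnorm (0 : O) = 0.
Proof. by rewrite -(scale0r (0 : O)) cnormZ normc0 mul0r. Qed.

Lemma cnormZr (r : R) x : 0 <= r -> cnorm (r%:C%C *: x) = r * cnorm x.
Proof. by move=> r0; rewrite cnormZ normc_real. Qed.

Lemma cnormN x : cnorm (- x) = cnorm x.
Proof.
rewrite -scaleN1r cnormZ /normc /= oppr0 expr0n addr0.
by rewrite sqrtr_sqr normrN1 mul1r.
Qed.

Lemma cnorm_ge0 x : 0 <= cnorm x.
Proof. by have := cnormD x (- x); rewrite subrr cnorm0 cnormN; lra. Qed.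

Lemma cnorm_sum (I : finType) (P : pred I) (F : I -> O) :
  cnorm (\sum_(i | P i) F i) <= \sum_(i | P i) cnorm (F i).
Proof.
elim/big_rec2: _ => [|i r x _ h]; first by rewrite cnorm0.
by rewrite (le_trans (cnormD _ _)) ?lerD2l.
Qed.

Lemma star0 : star (0 : O) = 0.
Proof. by have := starD (0 : O) 0; rewrite addr0 => /eqP; rewrite -subr_eq subrr => /eqP. Qed.

Lemma starN x : star (- x) = - star x.
Proof. by apply/eqP; rewrite -addr_eq0 -starD addNr star0. Qed.

Lemma starB x y : star (x - y) = star x - star y.
Proof. by rewrite starD starN. Qed.

Lemma star1 : star (1 : O) = 1.
Proof. by rewrite -[LHS]mul1r -[X in X * _]starK -starM mul1r starK. Qed.

Lemma star_sum (I : finType) (P : pred I) (F : I -> O) :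
  star (\sum_(i | P i) F i) = \sum_(i | P i) star (F i).
Proof. by apply: (big_morph _ (@starD _ _) star0). Qed.

Lemma star_eq0 x : (star x == 0) = (x == 0).
Proof. by apply/eqP/eqP => [|->]; [rewrite -{2}[x]starK => ->|]; rewrite star0. Qed.

Lemma star_mul_eq0 x : star x * x = 0 -> x = 0.
Proof.
move=> h; apply/cnorm_eq0/eqP; have := cnorm_starM x.
by rewrite h cnorm0 => /esym/eqP; rewrite sqrf_eq0.
Qed.

Lemma cnorm_proj p : star p = p -> p * p = p -> cnorm p <= 1.
Proof.
move=> sp pp; have := cnorm_starM p; rewrite sp pp => h.
have := cnorm_ge0 p; move: h; nra.
Qed.

(** * Contractions in the corner of a projection *)

Section Corner.
Variable p : O.
Hypothesis (sp : star p = p) (pp : p * p = p).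

(** In spectral terms the two bounds put the spectrum of [z] in the corner into both [[-2, 0]] and
    [[0, 2]], so that only [z = 0] can qualify. The lemmas below reach this by polynomial identities
    instead of spectral theory. *)
Definition near_unit z :=
  [/\ star z = z, p * z = z, z * p = z, cnorm (p + z) <= 1 & cnorm (p - z) <= 1].

(* [fun q => corner_eval z q] is multiplicative with [1 |-> p] and ['X |-> z],
   so that identities in the corner can be checked on commutative polynomials. *)
Definition corner_eval z (q : {poly R[i]}) : O := horner_alg z q * p.

Lemma near_unitN z : near_unit z -> near_unit (- z).
Proof. by case=> *; split; rewrite ?starN ?mulrN ?mulNr ?opprK //; congr (- _). Qed.

(* [8 (1 + 3/2 z) = 3 (1 + z)^3 + 3 (1 + z)^2 (1 - z) + (1 + i z)^3 + (1 - i z)^3]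
   writes [1 + 3/2 z] as a convex combination of contractions. *)
Lemma near_unit_grow z : near_unit z -> near_unit ((3%:R / 2%:R : R)%:C%C *: z).
Proof.
have conjr (r : R) : Num.conj (r%:C%C) = r%:C%C.
  by apply/eqP; rewrite eq_complex /= oppr0 !eqxx.
suff H z' : near_unit z' -> cnorm (p + (3%:R / 2%:R : R)%:C%C *: z') <= 1.
  move=> Qz; split; last first.
  - by rewrite -scalerN; apply/H/near_unitN.
  - exact: H.
  - by case: Qz => _ _ zp _ _; rewrite -scalerAl zp.
  - by case: Qz => _ pz _ _ _; rewrite -scalerAr pz.
  - by case: Qz => sz _ _ _ _; rewrite starZ sz conjr.
move=> {z} [sz pz zp pDz pBz]; set z := z' in sz pz zp pDz pBz *.
pose E := corner_eval z.
have cpz q : p * horner_alg z q = horner_alg z q * p.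
  apply: esym; elim/poly_ind: q => [|q c IH]; first by rewrite rmorph0 mul0r mulr0.
  rewrite rmorphD rmorphM /= horner_algX horner_algC mulrDl mulrDr.
  congr (_ + _); last by rewrite -scalerAl -scalerAr mul1r mulr1.
  by rewrite mulrA -IH -!mulrA pz zp.
have EM q1 q2 : E (q1 * q2) = E q1 * E q2.
  by rewrite /E /corner_eval rmorphM -!mulrA (mulrA p) cpz -mulrA pp.
have ED q1 q2 : E (q1 + q2) = E q1 + E q2.
  by rewrite /E /corner_eval rmorphD mulrDl.
have EZ (a : R[i]) q : E (a *: q) = a *: E q.
  by rewrite /E /corner_eval linearZ /= -!scalerAl mul1r.
have E1 : E 1 = p by rewrite /E /corner_eval rmorph1 mul1r.
have EX : E 'X = z by rewrite /E /corner_eval horner_algX zp.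
have ECX (a : R[i]) : E (1 + a%:P * 'X) = p + a *: z.
  by rewrite mul_polyC ED EZ E1 EX.
pose K q := cnorm (E q) <= 1.
have KM q1 q2 : K q1 -> K q2 -> K (q1 * q2).
  by move=> k1 k2; rewrite /K EM (le_trans (cnormM _ _)) // mulr_ile1 ?cnorm_ge0.
have Kp : K (1 + 'X) by rewrite /K ED E1 EX.
have Km : K (1 - 'X).
  by rewrite /K -scaleN1r ED EZ E1 EX scaleN1r.
have midK q1 q2 q : K q1 -> K q2 -> q1 + q2 = q + q -> K q.
  rewrite /K => k1 k2 e.
  have : cnorm (E q + E q) <= 2%:R.
    by rewrite -ED -e ED (le_trans (cnormD _ _)) // (natrD _ 1 1) lerD.
  have -> : E q + E q = (2%:R : R)%:C%C *: E q.
    by rewrite -[2%:R]/(1 + 1) rmorphD scalerDl scale1r.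
  by rewrite cnormZr //; lra.
have KX2 : K (1 + 'X * 'X).
  by apply: (midK ((1 + 'X) * (1 + 'X)) ((1 - 'X) * (1 - 'X))); [exact: KM..|ring].
have Ii : ('i%C : R[i])%:P * ('i%C)%:P = -1 :> {poly R[i]}.
  by rewrite -polyCM imag_sqr polyCN.
(* For [a] equal to [i] or [-i], the C*-identity reduces the norm of [p + a z] to that of [p + z^2],
   since [(1 - a X) (1 + a X) = 1 + X^2]. *)
have Ki (a : R[i]) : a * a = -1 -> Num.conj a = - a -> K (1 + a%:P * 'X).
  move=> aa ca; rewrite /K -(@ler_pXn2r _ 2) ?nnegrE ?cnorm_ge0 ?ler01 //.
  rewrite -cnorm_starM expr1n {1}ECX starD starZ sp sz ca -ECX -EM.
  suff -> : (1 + (- a)%:P * 'X) * (1 + a%:P * 'X) = 1 + 'X * 'X by [].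
  have: a%:P * a%:P = -1 :> {poly R[i]} by rewrite -polyCM aa polyCN.
  rewrite polyCN => {}aa.
  transitivity (1 - (a%:P * a%:P) * ('X * 'X) : {poly R[i]}); first by ring.
  by rewrite aa; ring.
(* [1 - 3 X^2] is the midpoint of [(1 + i X)^3] and [(1 - i X)^3]. *)
have K3 : K (1 - ('X * 'X + 'X * 'X + 'X * 'X)).
  pose u : {poly R[i]} := ('i%C)%:P * 'X.
  have uu : u * u = - ('X * 'X).
    by rewrite /u mulrACA Ii mulN1r.
  apply: (midK ((1 + u) * (1 + u) * (1 + u)) ((1 - u) * (1 - u) * (1 - u))).
  - by apply: (KM _ _ (KM _ _ _ _)); apply: Ki; rewrite ?imag_sqr ?conj_imag.
  - have -> : 1 - u = 1 + (- 'i%C)%:P * 'X by rewrite polyCN mulNr.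
    by apply: (KM _ _ (KM _ _ _ _));
      (apply: Ki; [rewrite mulrNN imag_sqr|rewrite raddfN; congr (- _); exact: conj_imag]).
  - transitivity (1 + 1 + (u * u) *+ 6); first by ring.
    by rewrite uu; ring.
have KB : K ((1 + 'X) * ((1 + 'X) * (1 - 'X))) by apply: (KM _ _ _ (KM _ _ _ _)).
have KC : K ((1 + 'X) * ((1 + 'X) * (1 + 'X))) by apply: (KM _ _ _ (KM _ _ _ _)).
have : cnorm ((8%:R : R)%:C%C *: (p + (3%:R / 2%:R : R)%:C%C *: z)) <= 8%:R.
  have -> : (8%:R : R)%:C%C *: (p + (3%:R / 2%:R : R)%:C%C *: z) =
      (3%:R : R)%:C%C *: E ((1 + 'X) * ((1 + 'X) * (1 - 'X))) +
      (3%:R : R)%:C%C *: E ((1 + 'X) * ((1 + 'X) * (1 + 'X))) +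
      (2%:R : R)%:C%C *: E (1 - ('X * 'X + 'X * 'X + 'X * 'X)).
    rewrite -E1 -EX -!(EZ, ED); congr E; rewrite -!mul_polyC.
    have e : (8%:R : R)%:C%C * (3%:R / 2%:R : R)%:C%C = 12%:R.
      by rewrite -rmorphM (_ : _ * _ = 12%:R) ?rmorph_nat //; lra.
    rewrite mulrDr mulrA -polyCM e !rmorph_nat; ring.
  apply: le_trans (cnormD _ _) _.
  have -> : 8%:R = 6%:R + 2%:R :> R by lra.
  apply: lerD; last by rewrite cnormZr //; move: K3; rewrite /K; lra.
  apply: le_trans (cnormD _ _) _; rewrite !cnormZr //.
  by move: KB KC; rewrite /K; lra.
by rewrite cnormZr //; lra.
Qed.

(* [near_unit] is stable under multiplication by [3/2] but bounds the norm. *)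
Lemma near_unit_eq0 z : near_unit z -> z = 0.
Proof.
have bnd y : near_unit y -> cnorm y <= 1.
  move=> [_ _ _ h1 h2].
  have : cnorm ((2%:R : R)%:C%C *: y) <= 2%:R.
    have -> : (2%:R : R)%:C%C *: y = (p + y) - (p - y).
      by rewrite rmorph_nat scaler_nat mulr2n opprB addrC addrA subrK.
    by apply: le_trans (cnormD _ _) _; rewrite cnormN; lra.
  by rewrite cnormZr //; lra.
move=> Qz; apply/cnorm_eq0/eqP; rewrite eq_le cnorm_ge0 andbT leNgt; apply/negP => n0.
(* Bernoulli's bound [1 + n/2 <= (3/2)^n] gives a growth that is easy to compare with
   [2 / cnorm z]. *)
have grow n : exists2 y, near_unit y & (1 + n%:R / 2%:R) * cnorm z <= cnorm y.
  elim: n => [|n [y Qy le]]; first by exists z; rewrite // mul0r addr0 mul1r.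
  exists ((3%:R / 2%:R : R)%:C%C *: y); first exact: near_unit_grow.
  rewrite cnormZr ?divr_ge0 // -[n.+1%:R]natr1.
  have : 0 <= n%:R * cnorm z by rewrite mulr_ge0 // ltW.
  by move: le; rewrite mulrDl; lra.
have [n ltn] : exists n : nat, 2%:R / cnorm z < n%:R.
  by exists (Num.truncn (2%:R / cnorm z)).+1; apply: truncnS_gt.
have [y /bnd y1 le] := grow n.
have := le_trans le y1; rewrite -ler_pdivlMr // mul1r => h.
have := ltn; rewrite -[2%:R / _]/(2%:R * _) mulrC.
have -> : (cnorm z)^-1 * 2%:R = 2%:R * (1 / cnorm z) by rewrite mul1r mulrC.
rewrite mul1r; lra.
Qed.

End Corner.

(** With [p = P i], compressing the sum by [p] and cancelling [p] leaves [x k = p P_k p] with total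
    [0] over [k != i]. Hence [x j] is minus a sum of [m] other terms, which bounds both [p + e x_j]
    and [p - e x_j] for small [e], and [near_unit_eq0] applies. *)
Lemma sum_proj_orthogonal (I : finType) (P : I -> O) :
  (forall i, star (P i) = P i) -> (forall i, P i * P i = P i) ->
  \sum_i P i = 1 -> forall i j, i != j -> P i * P j = 0.
Proof.
move=> sP PP sum1 i j ij; set p := P i.
suff : star (P j * p) * (P j * p) = 0.
  move=> /star_mul_eq0 h; apply/eqP; rewrite -star_eq0 starM !sP; exact/eqP.
rewrite starM /p !sP -/p mulrA -(mulrA p) PP.
pose x k := p * P k * p.
have sx k : star (x k) = x k by rewrite /x !starM !sP mulrA.
have px k : p * x k = x k by rewrite /x !mulrA PP.
have xp k : x k * p = x k by rewrite /x -!mulrA PP.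
have xB k : cnorm (p - x k) <= 1.
  have -> : p - x k = p * (1 - P k) * p by rewrite mulrBr mulrBl mulr1 PP.
  have p1 : cnorm p <= 1 by apply: cnorm_proj; rewrite ?sP ?PP.
  have q1 : cnorm (1 - P k) <= 1.
    apply: cnorm_proj; first by rewrite starB star1 sP.
    by rewrite mulrBr mulr1 mulrBl mul1r PP subrr subr0.
  rewrite (le_trans (cnormM _ _)) // mulr_ile1 ?cnorm_ge0 //.
  by rewrite (le_trans (cnormM _ _)) // mulr_ile1 ?cnorm_ge0.
have sumx : x j + \sum_(k | (k != i) && (k != j)) x k = 0.
  have : \sum_k x k = p by rewrite -mulr_suml -mulr_sumr sum1 mulr1 PP.
  rewrite (bigD1 i) //= (bigD1 j) 1?eq_sym //= /x /p !PP => /eqP.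
  by rewrite -subr_eq0 addrAC subrr add0r => /eqP.
set A := [pred k | (k != i) && (k != j)] in sumx.
pose m := #|A|.
have p1 : cnorm p <= 1 by apply: cnorm_proj; rewrite ?sP ?PP.
have h : cnorm (p *+ m + x j) <= m%:R.
  have -> : p *+ m + x j = \sum_(k in A) (p - x k).
    rewrite big_split /= sumrN sumr_const; congr (_ + _).
    by apply/eqP; rewrite -addr_eq0 sumx.
  apply: le_trans (cnorm_sum _ _) _.
  by rewrite -[m%:R]sumr_const; apply: ler_sum => k _.
(* The factor [1 / (m + 1)] fits because [(m + 1) p + x_j] and [(m + 1) p - x_j] are sums of [m + 1]
   contractions. *)
pose e : R := m.+1%:R^-1.
have e0 : 0 < e by rewrite invr_gt0.
have scaleK y : cnorm y <= m.+1%:R -> cnorm (e%:C%C *: y) <= 1.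
  by move=> le; rewrite (cnormZr _ (ltW e0)) /e ler_pdivrMl ?mulr1 ?ltr0Sn.
have ep : p = e%:C%C *: (p *+ m.+1).
  rewrite -scaler_nat scalerA -[m.+1%:R](rmorph_nat (real_complex R)) -rmorphM.
  by rewrite mulVf ?pnatr_eq0 // rmorph1 scale1r.
have /near_unit_eq0 : near_unit p (e%:C%C *: x j).
  split.
  - by rewrite starZ sx; congr (_ *: _); apply/eqP; rewrite eq_complex /= oppr0 !eqxx.
  - by rewrite -scalerAr px.
  - by rewrite -scalerAl xp.
  - rewrite {1}ep -scalerDr scaleK // mulrS -addrA.
    by rewrite (le_trans (cnormD _ _)) // -nat1r lerD.
  - rewrite {1}ep -scalerBr scaleK // mulrS addrAC.
    rewrite (le_trans (cnormD _ _)) // -nat1r lerD // -scaler_nat.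
    rewrite -[m%:R](rmorph_nat (real_complex R)) cnormZr //.
    by rewrite ler_piMr.
rewrite {1}/p sP PP => /(_ erefl erefl)/eqP; rewrite scaler_eq0.
move=> /orP[|/eqP//]; rewrite eq_complex /= => /andP[/eqP e00 _].
by rewrite e00 ltxx in e0.
Qed.

End CStar.

(** * Words in the Cuntz-Krieger generators *)

Section CuntzKrieger.
Variables (R : realType) (N : nat) (A : 'M[nat]_N).
Variables (O : cstarAlgType R) (S : edge A -> O).
Hypothesis hA : irreducible_mx A.
Hypothesis hS : cuntz_krieger (@edge_matrix N A) S.
Implicit Types (e f : edge A) (v w : 'I_N) (mu nu kappa : seq (edge A)).

Lemma range_proj_orthogonal e f :
  e != f -> S e * star (S e) * (S f * star (S f)) = 0.
Proof.
apply: (@sum_proj_orthogonal R O _ (fun e => S e * star (S e))) => [i|i|].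
- by rewrite starM starK.
- by rewrite mulrA (ck_pisom hS).
- exact: ck_sum1 hS.
Qed.

(** The projection of the vertex [v]: by the Cuntz-Krieger relation it equals [star (S e) * S e] for
    every edge [e] ending at [v]. *)
Definition vproj v : O := \sum_(e | source e == v) S e * star (S e).

Lemma star_vproj v : star (vproj v) = vproj v.
Proof. by rewrite star_sum; apply: eq_bigr => e _; rewrite starM starK. Qed.

Lemma starS_S e f : star (S e) * S f = if e == f then vproj (target e) else 0.
Proof.
case: eqVneq => [<-|ef].
  rewrite (ck_rel hS) [RHS]big_mkcond /=; apply: eq_bigr => j _.
  by rewrite /edge_matrix eq_sym; case: eqP => _; rewrite ?mul1r ?mul0r.
have pisom' : star (S e) * (S e * star (S e)) = star (S e).
  by rewrite -[in RHS](ck_pisom hS e) !starM starK.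
(* Both range projections are inserted between [star (S e)] and [S f], where they meet and
   annihilate each other. *)
rewrite -pisom' -(ck_pisom hS f) !mulrA -(mulrA _ (S e)) -(mulrA _ (S f)).
by rewrite -(mulrA (star (S e)) (S e * _)) range_proj_orthogonal // mulr0 mul0r.
Qed.

Lemma S_vproj e : S e * vproj (target e) = S e.
Proof. by have := starS_S e e; rewrite eqxx => <-; rewrite mulrA (ck_pisom hS). Qed.

Lemma vproj_starS e : vproj (target e) * star (S e) = star (S e).
Proof. by rewrite -{1}star_vproj -starM S_vproj. Qed.

Lemma vproj_S v e : vproj v * S e = if source e == v then S e else 0.
Proof.
rewrite mulr_suml; case: ifP => ev.
  rewrite (bigD1 e) //= -mulrA starS_S eqxx S_vproj big1 ?addr0 // => f /andP[_ fe].
  by rewrite -mulrA starS_S (negPf fe) mulr0.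
rewrite big1 // => f /eqP fv; rewrite -mulrA starS_S; case: eqP => [fe|]; last by rewrite mulr0.
by rewrite -fe fv eqxx in ev.
Qed.

Lemma vproj_vproj v w : vproj v * vproj w = if v == w then vproj v else 0.
Proof.
rewrite {2}/vproj mulr_sumr; case: eqVneq => [->|vw].
  by apply: eq_bigr => e ew; rewrite mulrA vproj_S ew.
rewrite big1 // => e /eqP ew; rewrite mulrA vproj_S ew.
by rewrite eq_sym (negPf vw) mul0r.
Qed.

Lemma connecting_edges v w n : (0 < (A ^+ n.+1) v w)%N ->
  exists e (mu : seq (edge A)), source e = v /\
    path (@edge_matrix N A) e mu /\ target (last e mu) = w.
Proof.
have edge_of i j : (0 < A i j)%N -> exists e : edge A, source e = i /\ target e = j.
  move=> Aij; pose k : 'I_(A (i, j).1 (i, j).2) := Ordinal Aij.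
  by exists (Tagged (fun ij => 'I_(A ij.1 ij.2)) k).
elim: n v => [|n IH] v; first by rewrite expr1 => /edge_of[e [se te]]; exists e, [::].
rewrite exprS mxE lt0n sum_nat_eq0 => /forallPn[/= k].
rewrite muln_eq0 negb_or -!lt0n => /andP[/edge_of[e [se te]] /IH[f [mu [sf [pf tf]]]]].
by exists e, (f :: mu); rewrite /= pf /edge_matrix te sf eqxx.
Qed.

(* The final vertex [v] is an argument, so that there is an empty path at each vertex. *)
Definition start mu v : 'I_N := if mu is e :: _ then source e else v.

Fixpoint is_path mu v : bool :=
  if mu is e :: mu' then (target e == start mu' v) && is_path mu' v else true.

Lemma start_cat mu nu v : start (mu ++ nu) v = start mu (start nu v).
Proof. by case: mu. Qed.

Lemma is_path_cat mu nu v :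
  is_path (mu ++ nu) v = is_path mu (start nu v) && is_path nu v.
Proof. by elim: mu => //= e mu ->; rewrite start_cat andbA. Qed.

Lemma path_is_path e mu :
  path (@edge_matrix N A) e mu -> is_path (e :: mu) (target (last e mu)).
Proof.
elim: mu e => [|f mu IH] e /=; first by rewrite eqxx.
by move=> /andP[ef /IH pmu]; apply/andP.
Qed.

Lemma connecting_path v w :
  exists mu, [/\ (0 < size mu)%N, is_path mu w & start mu w = v].
Proof.
have [n /connecting_edges[e [mu [se [pe te]]]]] := hA v w.
by exists (e :: mu); split; rewrite // -te; apply: path_is_path.
Qed.

Definition path_val mu : O := \prod_(e <- mu) S e.

(** The factor [vproj v] only matters for the empty path, whose value becomes the vertex projection
    instead of [1]. *)
Definition path_pisom mu v : O := path_val mu * vproj v.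

Lemma path_val_cat mu nu : path_val (mu ++ nu) = path_val mu * path_val nu.
Proof. exact: big_cat. Qed.

Lemma path_pisom_nil v : path_pisom [::] v = vproj v.
Proof. by rewrite /path_pisom /path_val big_nil mul1r. Qed.

Lemma path_pisom_cons e mu v : path_pisom (e :: mu) v = S e * path_pisom mu v.
Proof. by rewrite /path_pisom /path_val big_cons mulrA. Qed.

Lemma vproj_path mu v : is_path mu v ->
  vproj (start mu v) * path_pisom mu v = path_pisom mu v.
Proof.
case: mu => [|e mu] _; first by rewrite path_pisom_nil vproj_vproj eqxx.
by rewrite path_pisom_cons mulrA vproj_S eqxx.
Qed.

Lemma path_pisom_val mu v :
  (0 < size mu)%N -> is_path mu v -> path_val mu = path_pisom mu v.
Proof.
case: mu => // e mu _; elim: mu e => [|f mu IH] e /=.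
  by rewrite andbT => /eqP <-; rewrite /path_pisom /path_val big_seq1 S_vproj.
case/andP=> _ /IH h; rewrite path_pisom_cons -h.
by rewrite /path_val [LHS]big_cons.
Qed.

Lemma starS_path_same e mu v : is_path (e :: mu) v ->
  star (S e) * path_pisom (e :: mu) v = path_pisom mu v.
Proof.
case/andP=> /eqP te pmu.
by rewrite path_pisom_cons mulrA starS_S eqxx te vproj_path.
Qed.

Lemma starS_path_diff e f mu v : e != f ->
  star (S e) * path_pisom (f :: mu) v = 0.
Proof. by move=> ef; rewrite path_pisom_cons mulrA starS_S (negPf ef) mul0r. Qed.

Lemma S_path_eq0 e mu v : is_path mu v -> target e != start mu v ->
  S e * path_pisom mu v = 0.
Proof.
move=> pmu ne; rewrite -(vproj_path pmu) -S_vproj -!mulrA (mulrA (vproj _)).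
by rewrite vproj_vproj (negPf ne) mul0r mulr0.
Qed.

Lemma star_path_path mu v : is_path mu v ->
  star (path_pisom mu v) * path_pisom mu v = vproj v.
Proof.
elim: mu => [|e mu IH] pmu; first by rewrite !path_pisom_nil star_vproj vproj_vproj eqxx.
rewrite {1}path_pisom_cons starM -mulrA starS_path_same //.
by apply: IH; case/andP: pmu.
Qed.

Lemma vproj_neq0 v : vproj v != 0.
Proof.
have [mu [+ _ +]] := connecting_path v v; case: mu => //= e mu _ se.
apply/eqP => v0; have := vproj_S v e; rewrite v0 mul0r -se eqxx => /esym/eqP.
by rewrite (negPf (ck_neq0 hS e)).
Qed.

Lemma path_pisom_neq0 mu v : is_path mu v -> path_pisom mu v != 0.
Proof.
move=> /star_path_path h; apply/eqP => p0; move: h; rewrite p0 mulr0 => /esym/eqP.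
by rewrite (negPf (vproj_neq0 v)).
Qed.

Lemma path_pisomM mu nu v : is_path nu v ->
  path_pisom mu (start nu v) * path_pisom nu v = path_pisom (mu ++ nu) v.
Proof.
by move=> pnu; rewrite -mulrA vproj_path // /path_pisom path_val_cat mulrA.
Qed.

Lemma star_path_cat mu nu v : is_path (mu ++ nu) v ->
  star (path_pisom mu (start nu v)) * path_pisom (mu ++ nu) v = path_pisom nu v.
Proof.
rewrite is_path_cat => /andP[pmu pnu].
by rewrite -path_pisomM // mulrA star_path_path // vproj_path.
Qed.

Lemma star_path_diff mu nu v w : size mu = size nu -> mu != nu ->
  is_path mu v -> is_path nu w -> star (path_pisom mu v) * path_pisom nu w = 0.
Proof.
elim: mu nu => [|e mu IH] [|f nu] //= [sz] ne pmu pnu.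
rewrite path_pisom_cons starM -mulrA; case: (eqVneq e f) => [ef|ef]; last first.
  by rewrite starS_path_diff ?mulr0.
rewrite ef starS_path_same //; apply: IH => //.
- by apply: contraNneq ne => ->; rewrite ef.
- by case/andP: pmu.
- by case/andP: pnu.
Qed.

(** * Values of words, normal forms and synchronization *)

Definition word_val (u : seq (dyck_symbol A)) : O :=
  \prod_(c <- u) symbol_val S c.

Notation admissible w := (word_val w != 0).

Lemma word_val_cat u1 u2 : word_val (u1 ++ u2) = word_val u1 * word_val u2.
Proof. exact: big_cat. Qed.

Lemma word_val_cons c u : word_val (c :: u) = symbol_val S c * word_val u.
Proof. exact: big_cons. Qed.

Lemma word_val_beta mu : word_val (map inr mu) = path_val mu.
Proof. by rewrite /word_val big_map. Qed.

Lemma word_val_alpha mu : word_val (map inl (rev mu)) = star (path_val mu).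
Proof.
elim: mu => [|e mu IH]; first by rewrite /word_val /path_val !big_nil star1.
rewrite rev_cons map_rcons -cats1 word_val_cat IH /path_val big_cons starM.
by rewrite /word_val big_seq1.
Qed.

Lemma admissible_catl u1 u2 : admissible (u1 ++ u2) -> admissible u1.
Proof. by rewrite word_val_cat; apply: contraNneq => ->; rewrite mul0r. Qed.

Lemma admissible_catr u1 u2 : admissible (u1 ++ u2) -> admissible u2.
Proof. by rewrite word_val_cat; apply: contraNneq => ->; rewrite mulr0. Qed.

(** Inserting [1 = \sum_e S e * star (S e)] after [u] shows that some [beta_e] can follow; inserting
    it in front gives some [alpha_e] in the next lemma. *)
Lemma admissible_rcons u : admissible u -> exists c, admissible (rcons u c).
Proof.
move=> hu; apply: contrapT => /forallNP no; move: hu.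
rewrite -[word_val u]mulr1 -(ck_sum1 hS) mulr_sumr big1 ?eqxx // => e _.
have := no (inr e); rewrite -cats1 word_val_cat /word_val big_seq1 /= => /negP/negPn/eqP h.
by rewrite mulrA h mul0r.
Qed.

Lemma admissible_cons u : admissible u -> exists c, admissible (c :: u).
Proof.
move=> hu; apply: contrapT => /forallNP no; move: hu.
rewrite -[word_val u]mul1r -(ck_sum1 hS) mulr_suml big1 ?eqxx // => e _.
have := no (inl e); rewrite word_val_cons /= => /negP/negPn/eqP h.
by rewrite -mulrA h mulr0.
Qed.

Lemma path_val_neq0 mu : (0 < size mu)%N -> path_val mu != 0 ->
  exists v, is_path mu v.
Proof.
case: mu => // e mu _; elim: mu e => [|f mu IH] e h.
  by exists (target e); rewrite /= eqxx.
have [v pv] : exists v, is_path (f :: mu) v.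
  by apply: IH; apply: contraNneq h => h; rewrite /path_val big_cons -/(path_val _) h mulr0.
exists v; rewrite /= -/(is_path (f :: mu) v) pv andbT; apply/negPn/negP => te.
move: h; rewrite /path_val big_cons -/(path_val _) (path_pisom_val _ pv) //.
by rewrite S_path_eq0 ?eqxx.
Qed.

(** Read from right to left, each [beta] lengthens the path and each [alpha] removes its first edge
    or kills it. A word no longer than [mu] cannot use up the path, so the final vertex [v]
    survives. *)
Lemma word_val_path u mu v : is_path mu v -> (size u <= size mu)%N ->
  word_val u * path_pisom mu v = 0 \/
  exists2 nu, is_path nu v & word_val u * path_pisom mu v = path_pisom nu v.
Proof.
(* The induction also tracks the length of [nu], which excludes an [alpha] meeting an empty path. *)
move=> pmu; suff : (size u <= size mu)%N -> word_val u * path_pisom mu v = 0 \/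
    exists nu, [/\ is_path nu v, word_val u * path_pisom mu v = path_pisom nu v
                 & (size mu <= size nu + size u)%N].
  by move=> h /h [->|[nu [? ? _]]]; [left|right; exists nu].
elim: u => [|c u IH] szu.
  by right; exists mu; rewrite /word_val big_nil mul1r addn0.
have [h|[nu [pnu h sz]]] := IH (ltnW szu).
  by left; rewrite word_val_cons -mulrA h mulr0.
rewrite word_val_cons -mulrA h; case: c szu => e /= szu; last first.
  have [te|te] := boolP (target e == start nu v); last by left; apply: S_path_eq0.
  right; exists (e :: nu); split; rewrite /= ?te ?path_pisom_cons //.
  by rewrite addSn addnS !leqW.
case: nu => [|f nu] in pnu h sz *; first by move: (leq_trans szu sz); rewrite add0n ltnn.
have [ef|ef] := eqVneq e f; last by left; apply: starS_path_diff.
rewrite ef; right; exists nu; split; [by case/andP: pnu|exact: starS_path_same|].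
by rewrite addnS -addSn.
Qed.

(** The word [u] followed by [mu] reduces to a path [nu] ending at the same vertex [v] as [mu].
    Multiplying by its adjoint recovers [vproj v], so [z] sees [v] only and not [u]. *)
Lemma beta_synchronizing u mu z : (0 < size mu)%N -> (size u <= size mu)%N ->
  admissible (u ++ map inr mu) -> admissible (map inr mu ++ z) ->
  admissible (u ++ map inr mu ++ z).
Proof.
move=> mu0 szu hu; have := admissible_catr hu; rewrite word_val_beta.
case/(path_val_neq0 mu0) => v pmu; move: hu.
rewrite !word_val_cat word_val_beta (path_pisom_val mu0 pmu) mulrA.
have [->|[nu pnu ->]] := word_val_path pmu szu; first by rewrite eqxx.
move=> _; apply: contraNneq => h; rewrite /path_pisom -mulrA.
by rewrite -(star_path_path pnu) -mulrA h !mulr0.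
Qed.

Definition is_beta (c : dyck_symbol A) : bool := if c is inr _ then true else false.

Lemma word_normal_form u : (0 < size u)%N -> admissible u ->
  exists mu nu v, [/\ is_path mu v, is_path nu v,
    word_val u = path_pisom mu v * star (path_pisom nu v)
    & (size mu <= count is_beta u)%N].
Proof.
(* The induction prepends letters to a last letter [c], because the empty word has value [1], in
   general not of this form. *)
case/lastP: u => // u c _; rewrite -cats1 => hu.
elim: u hu => [|d u IH] /=.
  rewrite /word_val big_seq1 => _; case: c => e.
    exists [::], [:: e], (target e); split; rewrite //= ?eqxx //.
    rewrite path_pisom_nil path_pisom_cons path_pisom_nil starM star_vproj mulrA.
    by rewrite vproj_vproj eqxx vproj_starS.
  exists [:: e], [::], (target e); split; rewrite //= ?eqxx //.
  by rewrite !path_pisom_cons !path_pisom_nil star_vproj -mulrA vproj_vproj eqxx S_vproj.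
rewrite word_val_cons => hdu.
have /IH[mu [nu [v [pmu pnu e0 sz]]]] : word_val (u ++ [:: c]) != 0.
  by apply: contraNneq hdu => ->; rewrite mulr0.
move: hdu; rewrite e0 mulrA; case: d => e /= hdu; last first.
  exists (e :: mu), nu, v; split=> //.
    rewrite /= pmu andbT; apply: contraNT hdu => /(S_path_eq0 pmu) ->.
    by rewrite mul0r.
  by rewrite path_pisom_cons.
(* With [mu] used up, [alpha_e] extends [nu] at its end; otherwise it must cancel the first edge of
   [mu]. *)
case: mu => [|f mu] in pmu e0 sz hdu *.
  have sv : source e == v.
    apply: contraNT hdu => /negPf ev; rewrite path_pisom_nil.
    rewrite -[X in star (S e) * X]star_vproj -starM vproj_S ev.
    by rewrite star0 mul0r.
  have pe : is_path [:: e] (target e) by rewrite /= eqxx.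
  have pnue : is_path (nu ++ [:: e]) (target e) by rewrite is_path_cat pe /= (eqP sv) pnu.
  exists [::], (nu ++ [:: e]), (target e); split=> //.
  have -> : path_pisom nu v = path_pisom nu (start [:: e] (target e)) by rewrite /= (eqP sv).
  rewrite -path_pisomM // !path_pisom_nil path_pisom_cons path_pisom_nil S_vproj.
  rewrite -[X in star (S e) * X]star_vproj -starM vproj_S sv starM mulrA.
  by rewrite vproj_starS.
have ef : e = f by apply: contraNeq hdu => ef; rewrite starS_path_diff ?mul0r.
rewrite ef starS_path_same //; exists mu, nu, v; split=> //.
  by case/andP: pmu.
exact: ltnW.
Qed.

(* The word [alpha_(mu kappa)] can precede [u] and [beta_(nu kappa')] can follow it,
   but not both when [kappa] and [kappa'] are distinct paths of the same length. *)
Lemma not_synchronizing u mu nu v kappa kappa' w w' :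
  is_path mu v -> is_path nu v ->
  word_val u = path_pisom mu v * star (path_pisom nu v) ->
  is_path kappa w -> start kappa w = v -> is_path kappa' w' -> start kappa' w' = v ->
  size kappa = size kappa' -> kappa != kappa' ->
  let a := map inl (rev (mu ++ kappa)) in let b := map inr (nu ++ kappa') in
  [/\ admissible (a ++ u), admissible (u ++ b) & ~~ admissible (a ++ u ++ b)].
Proof.
move=> pmu pnu hu pk sk pk' sk' sz ne /=.
have k0 : (0 < size kappa)%N.
  by case: kappa kappa' sz ne {pk sk pk' sk'} => [|? ?] [|? ?].
have k0' : (0 < size kappa')%N by rewrite -sz.
have pmk : is_path (mu ++ kappa) w by rewrite is_path_cat sk pmu.
have pnk : is_path (nu ++ kappa) w by rewrite is_path_cat sk pnu.
have pmk' : is_path (mu ++ kappa') w' by rewrite is_path_cat sk' pmu.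
have pnk' : is_path (nu ++ kappa') w' by rewrite is_path_cat sk' pnu.
rewrite !word_val_cat word_val_alpha word_val_beta hu.
rewrite (path_pisom_val _ pmk) ?(path_pisom_val _ pnk') ?size_cat ?addn_gt0 ?k0 ?k0' ?orbT //.
have ea : star (path_pisom (mu ++ kappa) w) *
    (path_pisom mu v * star (path_pisom nu v)) = star (path_pisom (nu ++ kappa) w).
  rewrite mulrA -[path_pisom mu v]starK -starM -sk star_path_cat // -starM.
  by rewrite path_pisomM.
have eb : path_pisom mu v * star (path_pisom nu v) * path_pisom (nu ++ kappa') w' =
    path_pisom (mu ++ kappa') w'.
  by rewrite -mulrA -sk' star_path_cat // path_pisomM.
split; first by rewrite ea star_eq0 path_pisom_neq0.
  by rewrite eb path_pisom_neq0.
rewrite negbK mulrA ea star_path_diff ?eqxx ?size_cat ?sz //.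
by rewrite eqseq_cat // eqxx.
Qed.

Lemma forking_paths : (forall j, (2 <= \sum_(i < N) A i j)%N) ->
  exists M : nat, forall v, exists kappa kappa' w w',
    [/\ is_path kappa w /\ start kappa w = v,
        is_path kappa' w' /\ start kappa' w' = v,
        size kappa = size kappa', kappa != kappa' & (size kappa <= M)%N].
Proof.
move=> hcol.
suff H v : exists kappa kappa' w w',
    [/\ is_path kappa w /\ start kappa w = v,
        is_path kappa' w' /\ start kappa' w' = v,
        size kappa = size kappa' & kappa != kappa'].
  have [k hk] := choice H; exists (\max_v size (k v)) => v.
  have [k' [w [w' [? ? ? ?]]]] := hk v; exists (k v), k', w, w'; split=> //.
  exact: (leq_bigmax v).
(* Counting all edges by columns gives at least [2 N], so some row sum is at least [2]: a vertex [b]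
   with two outgoing edges, reachable from every [v]. *)
have [b hb] : exists b, (2 <= \sum_(j < N) A b j)%N.
  apply: contrapT => /forallNP no.
  have : (\sum_(i < N) \sum_(j < N) A i j <= \sum_(i < N) 1)%N.
    by apply: leq_sum => i _; rewrite leqNgt; apply/negP/no.
  rewrite exchange_big /=; have : (\sum_(j < N) 2 <= \sum_(j < N) \sum_(i < N) A i j)%N.
    by apply: leq_sum => j _; apply: hcol.
  move=> /leq_trans h /h; rewrite !sum_nat_const !card_ord leq_pmul2l //.
  exact: leq_ltn_trans (ltn_ord v).
have [e [f [se sf ef]]] : exists e f : edge A, [/\ source e = b, source f = b & e != f].
  pose ed j (x : 'I_(A b j)) : edge A :=
    Tagged (fun ij => 'I_(A ij.1 ij.2)) (x : 'I_(A (b, j).1 (b, j).2)).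
  have [[j hj]|] := pselect (exists j, (2 <= A b j)%N).
    exists (ed j (Ordinal (ltnW hj))), (ed j (Ordinal hj)); split=> //.
    by apply/negP; rewrite /ed eq_Tagged.
  move=> /forallNP no.
  have le1 j : (A b j <= 1)%N by rewrite leqNgt; apply/negP/no.
  have [j hj] : exists j, (0 < A b j)%N.
    apply: contrapT => /forallNP n0; move: hb; rewrite big1 // => j _.
    by apply/eqP; rewrite -leqn0 leqNgt; apply/negP/n0.
  have [j' jj' hj'] : exists2 j', j' != j & (0 < A b j')%N.
    apply: contrapT => n0; move: hb; rewrite (bigD1 j) //= big1 => [|k kj].
      by rewrite addn0 leqNgt ltnS le1.
    by apply/eqP; rewrite -leqn0 leqNgt; apply/negP => h; apply: n0; exists k.
  exists (ed j (Ordinal hj)), (ed j' (Ordinal hj')); split=> //.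
  by apply: contraNneq jj' => /(congr1 (@target N A)); rewrite /target /= => ->.
have [mu [mu0 pmu smu]] := connecting_path v b.
have pfork g : source g = b -> is_path (mu ++ [:: g]) (target g) /\
    start (mu ++ [:: g]) (target g) = v.
  by move=> sg; rewrite is_path_cat start_cat /= sg pmu smu eqxx.
exists (mu ++ [:: e]), (mu ++ [:: f]), (target e), (target f).
split; [exact: pfork|exact: pfork|by rewrite !size_cat|].
by rewrite eqseq_cat // eqxx /= eqseq_cons andbT.
Qed.

End CuntzKrieger.

(** * Blocks and points *)

Section Blocks.
Variable T : finType.
Implicit Types x y : full_shift T.

Definition agree x y (a b : int) := forall i, a <= i -> i < b -> x i = y i.

Lemma size_block x k n : size (block_word x k n) = n.
Proof. by rewrite size_map size_iota. Qed.

Lemma nth_block c0 x k n i : (i < n)%N ->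
  nth c0 (block_word x k n) i = x (k + i%:Z).
Proof. by move=> ltin; rewrite (nth_map 0%N) ?size_iota // nth_iota. Qed.

Lemma block_cat x k m n :
  block_word x k (m + n) = block_word x k m ++ block_word x (k + m%:Z) n.
Proof.
rewrite /block_word iotaD map_cat; congr (_ ++ _).
rewrite -[in LHS](addn0 (0 + m)%N) iotaDl -map_comp; apply: eq_map => i /=.
by rewrite add0n PoszD addrA.
Qed.

Lemma eq_block x y k n : agree x y k (k + n%:Z) ->
  block_word x k n = block_word y k n.
Proof.
move=> xy; apply/eq_in_map => i; rewrite mem_iota => /andP[_ lti].
by apply: xy; lia.
Qed.

Lemma block_agree x y k n : block_word x k n = block_word y k n ->
  agree x y k (k + n%:Z).
Proof.
move=> xy i ki ik; have -> : i = k + `|i - k|%N%:Z by lia.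
by rewrite -!(@nth_block (x 0) _ k n) ?xy //; lia.
Qed.

Lemma agree_sub x y a b a' b' : agree x y a b -> a <= a' -> b' <= b ->
  agree x y a' b'.
Proof. by move=> xy aa bb i ai ib; apply: xy; lia. Qed.

Lemma extend_word (L : set (seq T)) (u : seq T) (k : int) :
  (forall u v, L (u ++ v) -> L u) -> (forall u v, L (u ++ v) -> L v) ->
  (forall u, L u -> exists c, L (rcons u c)) -> (forall u, L u -> exists c, L (c :: u)) ->
  L u -> exists2 x, (forall k n, L (block_word x k n)) & block_word x k (size u) = u.
Proof.
move=> Ll Lr Lrcons Lcons Lu.
have [c0 _] := Lcons u Lu.
have ext v : exists p : T * T, L v -> L (p.1 :: rcons v p.2).
  have [Lv|nLv] := pselect (L v); last by exists (c0, c0).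
  by have [d /Lcons[c cd]] := Lrcons v Lv; exists (c, d).
have [g hg] := choice ext.
(* [W n] is meant to occupy the positions from [k - n] up to but excluding [k + size u + n]. *)
pose W n := iter n (fun u => (g u).1 :: rcons u (g u).2) u.
have WL n : L (W n) by elim: n => //= n /hg.
have szW n : size (W n) = (size u + n.*2)%N.
  by elim: n => [|n /= IH]; rewrite ?addn0 //= size_rcons IH doubleS !addnS.
have nthW m n j : (j < size (W n))%N -> nth c0 (W (n + m)%N) (j + m)%N = nth c0 (W n) j.
  move=> ltj; elim: m => [|m IH]; first by rewrite !addn0.
  by rewrite !addnS /= nth_rcons -IH szW; move: ltj; rewrite szW; case: ifP => //; lia.
(* The successor makes the chosen word contain position [i] even when [u] is empty. *)
pose x : full_shift T := fun i => nth c0 (W `|i - k|.+1) `|i - k + `|i - k|.+1%:Z|.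
have xE n i : 0 <= i - k + n%:Z -> i - k + n%:Z < (size u + n.*2)%N%:Z ->
    x i = nth c0 (W n) `|i - k + n%:Z|.
  move=> h1 h2; rewrite /x; set m := `|i - k|.+1.
  have [le|le] := leqP m n.
    rewrite -(nthW (n - m)%N); last by rewrite szW /m; lia.
    by rewrite subnKC //; congr nth; lia.
  rewrite -[RHS](nthW (m - n)%N); last by rewrite szW; lia.
  by rewrite subnKC 1?ltnW //; congr nth; lia.
exists x; last first.
  apply: (@eq_from_nth _ c0); first by rewrite size_block.
  move=> i; rewrite size_block => ltiu; rewrite nth_block // (xE 0%N) /=; last 2 first.
  - lia.
  - lia.
  by congr nth; lia.
move=> k' m; pose n := (absz (k' - k)%R + m)%N; pose a := absz (k' - k + n%:Z).
suff -> : block_word x k' m = take m (drop a (W n)).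
  apply: (Ll _ (drop m (drop a (W n)))); rewrite cat_take_drop.
  by apply: (Lr (take a (W n))); rewrite cat_take_drop.
have sz : (a + m <= size (W n))%N by rewrite szW /a /n; lia.
apply: (@eq_from_nth _ c0); rewrite size_block.
  by rewrite size_takel // size_drop; lia.
move=> i ltim; rewrite nth_block // nth_take // nth_drop (xE n); last 2 first.
- by rewrite /n; lia.
- by rewrite /n; lia.
by congr nth; rewrite /a /n; lia.
Qed.

(** The point [w] splices the past of [y] with the future of [z]. The horizon [n] is arbitrary but
    finite, so that [w] can be obtained by extending one admissible word. *)
Definition synchronizing_at (X : set (full_shift T)) (C : nat) x :=
  forall (l n : nat) (k : int) y z, X y -> X z ->
    agree y x k (k + (l + C)%N%:Z) -> agree z x k (k + (l + C)%N%:Z) ->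
    exists w, [/\ X w, agree w y (k - l%:Z) k & agree w z k (k + n%:Z)].

End Blocks.

(** * Synchronization in the Markov-Dyck shift *)

Section DyckShift.
Variables (R : realType) (N : nat) (A : 'M[nat]_N).
Variables (O : cstarAlgType R) (S : edge A -> O).
Hypothesis hA : irreducible_mx A.
Hypothesis hS : cuntz_krieger (@edge_matrix N A) S.
Implicit Types x y z : full_shift (dyck_symbol A).

Notation admissible w := (word_val S w != 0).

Lemma dyckP x : markov_dyck S x <-> forall k n, admissible (block_word x k n).
Proof. by split=> h k n; apply/eqP/h. Qed.

Lemma dyck_extend u k : admissible u ->
  exists2 x, markov_dyck S x & block_word x k (size u) = u.
Proof.
move=> hu; have [||||x hx <-] := @extend_word _ [set u | admissible u] u k _ _ _ _ hu.
- by move=> ? ?; apply: admissible_catl.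
- by move=> ? ?; apply: admissible_catr.
- by move=> ?; apply: admissible_rcons.
- by move=> ?; apply: admissible_cons.
by exists x; [apply/dyckP | rewrite size_block].
Qed.

Lemma pos_block x k n : markov_dyck_pos S x ->
  exists mu, size mu = n /\ block_word x k n = map inr mu.
Proof.
move=> [_ px]; have [f fx] := choice px.
exists [seq f (k + i%:Z) | i <- iota 0 n]; rewrite size_map size_iota; split=> //.
by rewrite -map_comp; apply: eq_map => i /=; rewrite fx.
Qed.

(** The constant [1] keeps the block of [beta] symbols nonempty when [l = 0], as
    [beta_synchronizing] requires. *)
Lemma pos_synchronizing x : markov_dyck_pos S x ->
  synchronizing_at (markov_dyck S) 1 x.
Proof.
move=> px l n k y z /dyckP Xy /dyckP Xz yx zx.
have [mu [szmu emu]] := pos_block k (l + 1) px.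
pose a := block_word y (k - l%:Z) l.
pose b := block_word z (k + (l + 1)%N%:Z) n.
have ha : admissible (a ++ map inr mu).
  rewrite -emu -(eq_block yx); have := Xy (k - l%:Z) (l + (l + 1))%N.
  by rewrite block_cat subrK.
have hb : admissible (map inr mu ++ b).
  by rewrite -emu -(eq_block zx); have := Xz k (l + 1 + n)%N; rewrite block_cat.
have := beta_synchronizing hS _ _ ha hb; rewrite size_block szmu addn1 leqnSn.
case/(_ erefl erefl)/(dyck_extend (k - l%:Z)) => w Xw.
rewrite /a /b !size_cat !size_block size_map szmu block_cat subrK (block_cat w k (l + 1) n) => /eqP.
rewrite !eqseq_cat ?size_block ?size_map ?szmu // => /and3P[/eqP wa /eqP wu /eqP wb].
exists w; split=> //.
  by have := block_agree wa; rewrite subrK.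
rewrite -emu -(eq_block zx) in wu.
have : block_word w k (l + 1 + n) = block_word z k (l + 1 + n).
  by rewrite (block_cat w) (block_cat z) wu wb.
by move=> /block_agree wz; apply: agree_sub wz _ _; lia.
Qed.

Lemma synchronizing_few_alpha :
  (forall j, (2 <= \sum_(i < N) A i j)%N) ->
  exists M : nat, forall C x, markov_dyck S x ->
    synchronizing_at (markov_dyck S) C x ->
    forall k n, (count (predC (@is_beta N A)) (block_word x k n) <= C + M)%N.
Proof.
move=> hcol; have [M hM] := forking_paths hA hcol.
exists M.+1 => C x Xx sync k n; set u0 := block_word x k n.
(* This is the length [l + C] for [l = n + M.+1], and it is positive. If [size mu > n], then [u] has
   more than [n] symbols [beta], hence few [alpha]; otherwise the word [a] below has length at most
   [l], and synchronization would join it to [b] across [u]. *)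
pose u := block_word x k (n + M.+1 + C).
suff h : (count (predC (@is_beta N A)) u <= C + M.+1)%N.
  apply: leq_trans h; rewrite /u -addnA block_cat count_cat; exact: leq_addr.
have Xx' := Xx; move/dyckP: Xx' => admx.
have szu : size u = (n + M.+1 + C)%N := size_block _ _ _.
have u_gt0 : (0 < size u)%N by rewrite szu; lia.
have [mu [nu [v [pmu pnu eu szmu]]]] := word_normal_form hS u_gt0 (admx _ _).
have := count_predC (@is_beta N A) u; rewrite size_block.
have [|lemu] := ltnP n (size mu); first by lia.
have [k1 [k2 [w1 [w2 [[p1 s1] [p2 s2] szk ne szM]]]]] := hM v.
have [] := not_synchronizing hA hS pmu pnu eu p1 s1 p2 s2 szk ne.
set a := map inl _; set b := map inr _ => au ub /negP[].
have [y Xy] := dyck_extend (k - (size a)%:Z) au.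
have [z Xz] := dyck_extend k ub.
rewrite !size_cat !block_cat subrK => /eqP; rewrite eqseq_cat ?size_block //.
move=> /andP[/eqP zu /eqP zb] /eqP; rewrite eqseq_cat ?size_block //.
move=> /andP[/eqP ya /eqP yu].
have sza : (size a <= n + M.+1)%N by rewrite /a size_map size_rev size_cat; lia.
have [||w [Xw wy wz]] := sync (n + M.+1)%N (n + M.+1 + C + size b)%N k y z Xy Xz.
- by apply: block_agree; rewrite yu.
- by apply: block_agree; rewrite zu.
move/dyckP: Xw => /(_ (k - (size a)%:Z) (size a + (n + M.+1 + C + size b))%N).
rewrite block_cat subrK (eq_block wz) block_cat.
rewrite (@eq_block _ w y); last first.
  by apply: agree_sub wy _ _; lia.
by rewrite ya zu zb.
Qed.

End DyckShift.

(** * Conjugacies of Markov-Dyck shifts *)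

Section Conjugacy.
Variables (T T' : finType) (X : set (full_shift T)) (X' : set (full_shift T')).
Variables (phi : full_shift T -> full_shift T') (psi : full_shift T' -> full_shift T).

Definition sliding (U V : finType) (Y : set (full_shift U))
    (f : full_shift U -> full_shift V) (r : nat) :=
  forall x y, Y x -> Y y -> forall a b,
    agree x y (a - r%:Z) (b + r%:Z) -> agree (f x) (f y) a b.

(** The points [y] and [z] are pulled back by [psi], spliced there, and the result is pushed forward
    by [phi]. Each code loses [r] symbols at each end of an interval, whence [4 * r]. *)
Lemma synchronizing_conj r C x :
  (forall x, X x -> X' (phi x)) -> (forall y, X' y -> X (psi y)) ->
  (forall x, X x -> psi (phi x) = x) -> (forall y, X' y -> phi (psi y) = y) ->
  sliding X phi r -> sliding X' psi r ->
  X x -> synchronizing_at X C x -> synchronizing_at X' (C + 4 * r)%N (phi x).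
Proof.
move=> phiX psiX phiK psiK sphi spsi Xx sync l n k y z X'y X'z yx zx.
have transfer u : X' u -> agree u (phi x) k (k + (l + (C + 4 * r))%N%:Z) ->
    agree (psi u) x (k + r%:Z) (k + r%:Z + (l + 2 * r + C)%N%:Z).
  move=> X'u ux; rewrite -(phiK x) //; apply: spsi => //; first exact: phiX.
  by apply: agree_sub ux _ _; lia.
have [py pz] := (transfer y X'y yx, transfer z X'z zx).
have [w [Xw wy wz]] := sync (l + 2 * r)%N (n + l + C + 4 * r)%N (k + r%:Z) _ _
  (psiX _ X'y) (psiX _ X'z) py pz.
(* Past [k + r] the points [psi y], [x] and [psi z] agree on the block, so [w] follows [psi y] far
   enough to the right for [phi] to be applied. *)
have {}wy : agree (phi w) y (k - l%:Z) (k + 2%:Z * r%:Z).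
  rewrite -(psiK y) //; apply: sphi => //; first exact: psiX.
  move=> i ai ib; have [lti|lei] := ltP i (k + r%:Z); first by apply: wy; lia.
  by rewrite wz ?pz ?py //; lia.
have {}wz : agree (phi w) z (k + 2%:Z * r%:Z) (k + n%:Z).
  rewrite -(psiK z) //; apply: sphi => //; first exact: psiX.
  by apply: agree_sub wz _ _; lia.
exists (phi w); split; [exact: phiX|by apply: agree_sub wy _ _; lia|].
move=> i ai ib; have [lti|lei] := ltP i (k + 2%:Z * r%:Z); last by apply: wz; lia.
by rewrite wy ?yx ?zx //; lia.
Qed.

End Conjugacy.

Definition translate (T : finType) (m : int) (x : full_shift T) : full_shift T :=
  fun n => x (n + m).

Lemma subshift_translate (T : finType) (F : set (seq T)) m x :
  subshift F x -> subshift F (translate m x).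
Proof.
move=> Fx k n; have := Fx (k + m) n.
by rewrite /block_word /translate; under eq_map do rewrite addrAC.
Qed.

Lemma subshift_shift_map (T : finType) (F : set (seq T)) x :
  subshift F x -> subshift F (shift_map x).
Proof. exact: (@subshift_translate _ _ 1). Qed.

Lemma translate_conj (T T' : finType) (X : set (full_shift T))
    (phi : full_shift T -> full_shift T') :
  (forall m x, X x -> X (translate m x)) ->
  (forall x, X x -> phi (shift_map x) = shift_map (phi x)) ->
  forall m x, X x -> phi (translate m x) = translate m (phi x).
Proof.
move=> Xtr phis.
have tr0 (U : finType) (x : full_shift U) : translate 0 x = x.
  by apply/funext => n; rewrite /translate addr0.
have trS (U : finType) (x : full_shift U) m : translate (m + 1) x = shift_map (translate m x).
  by apply/funext => n; rewrite /translate /shift_map -addrA (addrC 1).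
have step m x : X x -> phi (translate (m + 1) x) = shift_map (phi (translate m x)).
  by move=> Xx; rewrite trS phis //; apply: Xtr.
have shift_inj (U : finType) (x y : full_shift U) : shift_map x = shift_map y -> x = y.
  move=> /funeqP xy; apply/funext => n; have := xy (n - 1).
  by rewrite /shift_map subrK.
elim/int_rect => [|n IH|n IH] x Xx; first by rewrite !tr0.
  by rewrite (_ : n.+1%:Z = n%:Z + 1) ?step ?trS ?IH //; lia.
(* Negative translations are reached by shifting both sides once and using injectivity of the
   shift. *)
apply: shift_inj; rewrite -step // -trS.
have -> : - n.+1%:Z + 1 = - n%:Z by lia.
exact: IH.
Qed.

(** * Periodic points of the edge shift *)

Section Positive.
Variables (R : realType) (N : nat) (A : 'M[nat]_N).
Variables (O : cstarAlgType R) (S : edge A -> O).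
Hypothesis hA : irreducible_mx A.
Hypothesis hS : cuntz_krieger (@edge_matrix N A) S.

Lemma edge_path_pos (f : int -> edge A) :
  (forall j, target (f j) = source (f (j + 1))) ->
  markov_dyck_pos S (fun j => inr (f j)).
Proof.
move=> hf; split; last by move=> n; exists (f n).
apply/dyckP => k n.
pose mu k n := [seq f (k + i%:Z) | i <- iota 0 n].
have -> : @block_word (dyck_symbol A) (fun j => inr (f j)) k n = map inr (mu k n).
  by rewrite /mu /block_word -map_comp.
have pmu : forall n k, is_path (mu k n) (source (f (k + n%:Z))).
  elim=> {k} {}n // IH k; rewrite /mu /= addr0.
  have -> : [seq f (k + i%:Z) | i <- iota 1 n] = mu (k + 1) n.
    rewrite -[1%N]addn0 iotaDl -map_comp; apply: eq_map => i /=.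
    by rewrite PoszD addrA.
  have := IH (k + 1); rewrite -addrA -PoszD add1n => ->; rewrite andbT hf.
  by case: (n) => [|m]; rewrite /= ?addr0.
case: n => [|n]; first by rewrite /word_val /block_word big_nil oner_neq0.
rewrite word_val_beta (path_pisom_val hS _ (pmu _ _)) ?size_map //.
by rewrite (path_pisom_neq0 hA hS).
Qed.

Lemma is_path_nth e0 (mu : seq (edge A)) v i : is_path mu v -> (i.+1 < size mu)%N ->
  target (nth e0 mu i) = source (nth e0 mu i.+1).
Proof.
elim: mu i => // e mu IH [|i] /= /andP[/eqP te pmu]; last by move=> h; apply: IH.
by case: mu te {IH pmu}.
Qed.

Lemma is_path_last e0 (mu : seq (edge A)) v : is_path mu v -> (0 < size mu)%N ->
  target (nth e0 mu (size mu).-1) = v.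
Proof.
case: mu => // e mu; elim: mu e => [|f mu IH] e; first by rewrite /= andbT => /eqP.
by case/andP=> _ /IH; apply.
Qed.

(** By irreducibility the path read in the block closes up to a cycle, which is repeated with its
    start placed at [k]. *)
Lemma periodic_approx x (k : int) n : markov_dyck_pos S x -> (0 < n)%N ->
  exists p P, [/\ markov_dyck_pos S p, (0 < P)%N, translate P%:Z p = p
                & agree x p k (k + n%:Z)].
Proof.
move=> px n0; have [mu [szmu emu]] := pos_block k n px.
have mu0 : (0 < size mu)%N by rewrite szmu.
have [v pmu] : exists v, is_path mu v.
  apply: (path_val_neq0 hS mu0); rewrite -word_val_beta -emu.
  by case: px => /dyckP.
have [kappa [k0 pk sk]] := connecting_path hA v (start mu v).
pose c := mu ++ kappa; pose P := size c.
have P0 : (0 < P)%N by rewrite /P size_cat addn_gt0 mu0.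
have [e0 _] : exists e0 : edge A, True by case: (mu) mu0 => // e; exists e.
have pc : is_path c (start mu v) by rewrite is_path_cat sk pmu.
pose f j := nth e0 c `|modz (j - k) P%:Z|%N.
have fj j : target (f j) = source (f (j + 1)).
  rewrite /f addrAC; set a := j - k.
  have Pn : P%:Z != 0 by rewrite -lt0n.
  have m0 := modz_ge0 a Pn; have mP := ltz_mod a Pn.
  have -> : modz (a + 1) P%:Z = modz (modz a P%:Z + 1) P%:Z by rewrite modzDml.
  move: (modz a P%:Z) m0 mP => m m0 mP.
  (* Either the two edges are consecutive inside [c], or the last edge of [c] is followed by its
     first one. *)
  have [lt|ge] := ltnP `|m|.+1 P.
    rewrite modz_small; last by clearbody P; lia.
    by rewrite (is_path_nth e0 pc lt); congr (source (nth _ _ _)); lia.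
  have -> : m + 1 = P%:Z by clearbody P; lia.
  rewrite modzz /=.
  have -> : `|m|%N = P.-1 by clearbody P; lia.
  rewrite (is_path_last e0 pc P0) /c; case: (mu) mu0 => //.
exists (fun j => inr (f j)), P; split=> //; first exact: edge_path_pos.
  by apply/funext => j; rewrite /translate /f addrAC modzDr.
rewrite -szmu; apply: block_agree; rewrite szmu emu.
apply: (@eq_from_nth _ (inr e0)); first by rewrite size_block size_map.
rewrite size_map szmu => i lti; rewrite nth_block // (nth_map e0) ?szmu //.
congr inr; rewrite /f addrAC subrr add0r modz_small; last first.
  by rewrite /P size_cat szmu; lia.
by rewrite nth_cat szmu lti.
Qed.

End Positive.

Lemma count_periodic (T : finType) (a : pred T) (x : full_shift T) (P : nat) (i : int) K :
  (0 < P)%N -> translate P%:Z x = x -> a (x i) ->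
  (K <= count a (block_word x i (K * P)))%N.
Proof.
move=> P0 xP axi; elim: K => // K IH.
rewrite mulSn addnC block_cat count_cat -[K.+1]addn1 leq_add //.
have -> : block_word x (i + (K * P)%N%:Z) P = block_word x i P.
  rewrite /block_word; apply: eq_map => j; elim: (K) => [|m IHm]; first by rewrite addr0.
  rewrite -IHm -[in RHS]xP /translate; congr x; lia.
by case: P P0 {xP IH} => // P _; rewrite /block_word /= addr0 axi.
Qed.

Section PositivePreserved.
Variables (R : realType) (N N' : nat) (A : 'M[nat]_N) (A' : 'M[nat]_N').
Variables (O O' : cstarAlgType R) (S : edge A -> O) (S' : edge A' -> O').
Hypotheses (hA : irreducible_mx A) (hA' : irreducible_mx A').
Hypothesis hS : cuntz_krieger (@edge_matrix N A) S.
Hypothesis hS' : cuntz_krieger (@edge_matrix N' A') S'.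
Hypothesis hcol' : forall j, (2 <= \sum_(i < N') A' i j)%N.

(** The symbol of [phi x] at [i] is also the symbol of [phi p] for a periodic point [p] close to
    [x]. An [alpha] there would recur in every period, against the bound on the number of [alpha]
    symbols in a synchronizing point. *)
Lemma conj_pos phi psi r :
  (forall x, markov_dyck S x -> markov_dyck S' (phi x)) ->
  (forall y, markov_dyck S' y -> markov_dyck S (psi y)) ->
  (forall x, markov_dyck S x -> psi (phi x) = x) ->
  (forall y, markov_dyck S' y -> phi (psi y) = y) ->
  sliding (markov_dyck S) phi r -> sliding (markov_dyck S') psi r ->
  (forall x, markov_dyck S x -> phi (shift_map x) = shift_map (phi x)) ->
  forall x, markov_dyck_pos S x -> markov_dyck_pos S' (phi x).
Proof.
move=> phiX psiX phiK psiK sphi spsi phis x px; have [Xx _] := px.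
split=> [|i]; first exact: phiX.
(* The length [2 r + 1] is the window on which [phi x i] depends. *)
have [p [P [pp P0 pP xp]]] := periodic_approx hA hS (i - r%:Z) px (ltn0Sn (r + r)).
have [Xp _] := pp.
have -> : phi x i = phi p i.
  by apply: (sphi x p Xx Xp i (i + 1)); [apply: agree_sub xp _ _; lia|lia..].
have pP' : translate P%:Z (phi p) = phi p.
  rewrite -{2}pP (translate_conj _ phis) // => m y; exact: subshift_translate.
have sp := synchronizing_conj phiX psiX phiK psiK sphi spsi Xp (pos_synchronizing hS pp).
have [M few] := synchronizing_few_alpha hA' hS' hcol'.
set C := (1 + 4 * r)%N in sp.
have := few C (phi p) (phiX _ Xp) sp i ((C + M).+1 * P)%N.
case E : (phi p i) => [e|e]; last by exists e.
have := @count_periodic _ (predC (@is_beta N' A')) (phi p) P i (C + M).+1 P0 pP'.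
by rewrite /= E => /(_ erefl) /leq_trans h /h; rewrite ltnn.
Qed.

End PositivePreserved.

(** * Sliding block codes and skew products *)

Section Window.
Variables T T' : finType.

Lemma cylinder_basis (x : full_shift T) (U : set (full_shift T)) : nbhs x U ->
  exists r : nat, forall y, agree x y (- r%:Z) (r%:Z + 1) -> U y.
Proof.
(* The cylinders around [x] generate a filter that converges to [x] at each coordinate, hence in the
   product topology. *)
pose F : set_system (full_shift T) :=
  [set U | exists r : nat, forall y, agree x y (- r%:Z) (r%:Z + 1) -> U y].
have FF : Filter F.
  split; first by exists 0%N.
    move=> P Q [r hr] [s hs]; exists (maxn r s) => y xy.
    by split; [apply: hr|apply: hs]; apply: agree_sub xy _ _; lia.
  by move=> P Q PQ [r hr]; exists r => y /hr /PQ.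
apply: (@pointwise_cvgP (discrete_topology int) (discrete_topology T) F x FF).2 => t V Vx.
exists `|t|%N => y xy /=; rewrite -(xy t); [exact: nbhs_singleton Vx|lia|lia].
Qed.

Lemma cylinder_nbhs (x : full_shift T) (r : nat) :
  nbhs x [set y | agree x y (- r%:Z) (r%:Z + 1)].
Proof.
have coord i : nbhs x [set y : full_shift T | x i = y i].
  have := @proj_continuous int (fun=> discrete_topology T) i x [set c | x i = c].
  by apply; rewrite nbhs_principalE; apply/principal_filterP.
suff all_coords m : nbhs x [set y : full_shift T |
    forall i : nat, (i < m)%N -> x (- r%:Z + i%:Z) = y (- r%:Z + i%:Z)].
  apply: filterS (all_coords (r + r + 1)%N) => y xy i ai ib.
  have -> : i = - r%:Z + (absz (i + r%:Z))%:Z by lia.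
  by apply: xy; lia.
elim: m => [|m IH]; first exact: filterS filterT.
apply: filterS (filterI IH (coord (- r%:Z + m%:Z))) => y [xy xym] i.
by rewrite ltnS leq_eqVlt => /orP[/eqP ->//|]; apply: xy.
Qed.

Lemma full_shift_compact : compact [set: full_shift T].
Proof.
have := @tychonoff int (fun=> discrete_topology T) (fun=> setT).
have -> : [set f : int -> discrete_topology T | forall i, [set: discrete_topology T] (f i)] = setT.
  by rewrite -subTset.
apply=> _; apply: finite_compact; exact: finite_finset.
Qed.

Lemma subshift_compact (F : set (seq T)) : compact (subshift F).
Proof.
apply: (subclosed_compact _ full_shift_compact) => // x clx k n.
have [y [Fy xy]] := clx _ (cylinder_nbhs x (absz k + n)).
rewrite (@eq_block _ x y); first exact: Fy.
by apply: agree_sub xy _ _; lia.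
Qed.

(** Compactness turns the radii that work near each single point into one uniform radius. *)
Lemma local_window (X : set (full_shift T)) (phi : full_shift T -> full_shift T') :
  compact X ->
  (forall x, X x -> nbhs x [set y | X y -> phi y 0 = phi x 0]) ->
  exists r : nat, forall x y, X x -> X y ->
    agree x y (- r%:Z) (r%:Z + 1) -> phi x 0 = phi y 0.
Proof.
move=> /compact_near_coveringP cX cphi.
pose P (r : nat) (x : full_shift T) := X x -> forall y, X y ->
  agree x y (- r%:Z) (r%:Z + 1) -> phi x 0 = phi y 0.
have [|r _ /(_ r (leqnn r)) Pr] := cX nat \oo P _.
  move=> x /cphi /cylinder_basis[r0 hr0].
  exists ([set y | agree x y (- r0%:Z) (r0%:Z + 1)], [set r | (r0 <= r)%N]) => /=.
    by split; [exact: cylinder_nbhs|exists r0].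
  move=> [x' r] [/= xx' ler] Xx' y Xy x'y.
  rewrite hr0 // hr0 // => i ai ib; rewrite xx' // x'y //; lia.
by exists r => x y Xx; apply: Pr.
Qed.

Lemma sliding_of_window (X : set (full_shift T)) (phi : full_shift T -> full_shift T') r s :
  (forall m x, X x -> X (translate m x)) ->
  (forall x, X x -> phi (shift_map x) = shift_map (phi x)) ->
  (forall x y, X x -> X y -> agree x y (- r%:Z) (r%:Z + 1) -> phi x 0 = phi y 0) ->
  (r <= s)%N -> sliding X phi s.
Proof.
move=> Xtr phis win rs x y Xx Xy a b xy i ai ib.
have := win _ _ (Xtr i x Xx) (Xtr i y Xy).
rewrite !(translate_conj Xtr phis) // /translate !add0r; apply=> j aj jb.
by apply: xy; lia.
Qed.

End Window.

(** * Equivariant maps between skew products *)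

Section SkewProduct.
Variables (gT : finGroupType) (T T' : finType).
Variables (X : set (full_shift T)) (X' : set (full_shift T')).
Variables (t : full_shift T -> gT) (t' : full_shift T' -> gT).
Variable f : gs_top (skew_product X t) -> gs_top (skew_product X' t').
Hypothesis fX : set_fun (gs_space (skew_product X t)) (gs_space (skew_product X' t')) f.
Hypothesis f_act : {in gs_space (skew_product X t),
  forall x, forall g, f (gs_act _ g x) = gs_act _ g (f x)}.

(** The map induced on orbit spaces, read on the fibre over [1]; equivariance makes every other
    fibre give the same result. *)
Definition base_map (x : full_shift T) : full_shift T' := (f (1%g, x)).2.

Lemma snd_skew g x : X x -> (f (g, x)).2 = base_map x.
Proof.
move=> Xx; have := f_act (x := (1%g, x)) (mem_set Xx) g.
by rewrite /= mulg1 => ->.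
Qed.

Lemma base_map_in x : X x -> X' (base_map x).
Proof. by move=> Xx; apply: (fX (x := (1%g, x))). Qed.

Lemma base_map_shift x : (forall x, X x -> X (shift_map x)) ->
  {in gs_space (skew_product X t), forall x, f (gs_dyn _ x) = gs_dyn _ (f x)} ->
  X x -> base_map (shift_map x) = shift_map (base_map x).
Proof.
move=> Xs fdyn Xx; have := fdyn (1%g, x) (mem_set Xx) => /= e.
by rewrite -(snd_skew (1 * t x)%g (Xs _ Xx)) e.
Qed.

Lemma base_map_continuous : {within gs_space (skew_product X t), continuous f} ->
  forall x, X x -> nbhs x [set y | X y -> base_map y 0 = base_map x 0].
Proof.
move=> /subspace_continuousP fc x Xx.
have /(fc (1%g, x)) : gs_space (skew_product X t) (1%g, x) by [].
pose W := [set z : gs_top (skew_product X' t') | z.2 0 = base_map x 0].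
have nW : nbhs (f (1%g, x)) W.
  exists (setT, [set y | agree (base_map x) y (- 0%:Z) (0%:Z + 1)]) => /=.
    by split; [exact: filterT|exact: cylinder_nbhs].
  by move=> [g y] [_ /= xy]; rewrite /W /= -xy.
move=> /(_ W nW) [[U V] /= [U1 Vx] UV].
apply: filterS Vx => y Vy Xy.
by apply: (UV (1%g, y)) => //; split=> //=; exact: nbhs_singleton U1.
Qed.

End SkewProduct.

(** The base maps of [f] and [h] are inverse conjugacies of the Markov-Dyck shifts, so [conj_pos]
    applies in both directions. *)
Lemma markov_dyck_skew_pos (R : realType) (gT : finGroupType)
    (N N' : nat) (A : 'M[nat]_N) (A' : 'M[nat]_N')
    (O O' : cstarAlgType R) (S : edge A -> O) (S' : edge A' -> O')
    (l : dyck_symbol A -> gT) (l' : dyck_symbol A' -> gT) :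
  irreducible_mx A -> irreducible_mx A' ->
  (forall j, (2 <= \sum_(i < N) A i j)%N) -> (forall j, (2 <= \sum_(i < N') A' i j)%N) ->
  cuntz_krieger (@edge_matrix N A) S -> cuntz_krieger (@edge_matrix N' A') S' ->
  G_conjugate (markov_dyck_skew S l) (markov_dyck_skew S' l') ->
  G_conjugate (markov_dyck_pos_skew S l) (markov_dyck_pos_skew S' l').
Proof.
move=> hA hA' hcol hcol' hS hS' [f [h [[fc hc] [fX hX] [fK hK] fdyn fact]]].
have hact : {in gs_space (markov_dyck_skew S' l'),
    forall y, forall g,
      h (gs_act (markov_dyck_skew S' l') g y) = gs_act (markov_dyck_skew S l) g (h y)}.
  move=> y /set_mem Yy g; have Xhy := hX _ Yy.
  by rewrite -{1}[y]hK ?mem_set // -fact ?mem_set // fK // mem_set.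
have hdyn : {in gs_space (markov_dyck_skew S' l'),
    forall y, h (gs_dyn (markov_dyck_skew S' l') y) = gs_dyn (markov_dyck_skew S l) (h y)}.
  move=> y /set_mem Yy; have Xhy := hX _ Yy.
  rewrite -{1}[y]hK ?mem_set // -fdyn ?mem_set // fK // mem_set //.
  exact: (subshift_shift_map Xhy).
pose phi := base_map f; pose psi := base_map h.
have phiX x : markov_dyck S x -> markov_dyck S' (phi x).
  exact: (@base_map_in _ _ _ _ _ (tau l) (tau l') f fX x).
have psiX y : markov_dyck S' y -> markov_dyck S (psi y).
  exact: (@base_map_in _ _ _ _ _ (tau l') (tau l) h hX y).
have phiK x : markov_dyck S x -> psi (phi x) = x.
  move=> Xx; rewrite /psi -(snd_skew hact (f (1%g, x)).1 (phiX _ Xx)).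
  by rewrite /phi /base_map -surjective_pairing fK ?mem_set.
have psiK y : markov_dyck S' y -> phi (psi y) = y.
  move=> Yy; rewrite /phi -(snd_skew fact (h (1%g, y)).1 (psiX _ Yy)).
  by rewrite /psi /base_map -surjective_pairing hK ?mem_set.
have phis x : markov_dyck S x -> phi (shift_map x) = shift_map (phi x).
  by apply: (base_map_shift fact _ fdyn) => y; apply: (@subshift_shift_map _ _).
have psis y : markov_dyck S' y -> psi (shift_map y) = shift_map (psi y).
  by apply: (base_map_shift hact _ hdyn) => x; apply: (@subshift_shift_map _ _).
have [r win] := local_window (@subshift_compact _ _) (base_map_continuous fc).
have [r' win'] := local_window (@subshift_compact _ _) (base_map_continuous hc).
(* The larger radius serves both codes, since [conj_pos] uses a single one. *)
have sphi : sliding (markov_dyck S) phi (maxn r r').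
  by apply: sliding_of_window phis win (leq_maxl _ _) => m x; apply: subshift_translate.
have spsi : sliding (markov_dyck S') psi (maxn r r').
  by apply: sliding_of_window psis win' (leq_maxr _ _) => m x; apply: subshift_translate.
have phi_pos := conj_pos hA hA' hS hS' hcol' phiX psiX phiK psiK sphi spsi phis.
have psi_pos := conj_pos hA' hA hS' hS hcol psiX phiX psiK phiK spsi sphi psis.
have sub : gs_space (markov_dyck_pos_skew S l) `<=` gs_space (markov_dyck_skew S l).
  by move=> x [].
have sub' : gs_space (markov_dyck_pos_skew S' l') `<=` gs_space (markov_dyck_skew S' l').
  by move=> x [].
(* Membership in the restricted space depends on the second coordinate only, so [f] and [h]
   themselves restrict. *)
exists f, h; split.
- by split; [apply: continuous_subspaceW fc | apply: continuous_subspaceW hc].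
- split=> -[g x] px; rewrite /= /markov_dyck_pos_skew /=.
    by rewrite (snd_skew fact g (proj1 px)); apply: phi_pos.
  by rewrite (snd_skew hact g (proj1 px)); apply: psi_pos.
- split=> x /set_mem px; first by apply: fK; apply/mem_set/sub.
  by apply: hK; apply/mem_set/sub'.
- by move=> x /set_mem px; apply: fdyn; apply/mem_set/sub.
- by move=> x /set_mem px; apply: fact; apply/mem_set/sub.
Qed.

Theorem corollary7p6 (R : realType) (gT : finGroupType)
    (N : nat) (A : 'M[nat]_N)
    (hA : irreducible_mx A)
    (hcol : forall j, (2 <= \sum_(i < N) A i j)%N)
    (O : cstarAlgType R) (S : edge A -> O)
    (hS : cuntz_krieger (@edge_matrix N A) S) :
  (forall (l : dyck_symbol A -> gT)
      (N' : nat) (A' : 'M[nat]_N')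
      (hA' : irreducible_mx A')
      (hcol' : forall j, (2 <= \sum_(i < N') A' i j)%N)
      (O' : cstarAlgType R) (S' : edge A' -> O')
      (hS' : cuntz_krieger (@edge_matrix N' A') S')
      (l' : dyck_symbol A' -> gT),
    G_conjugate (markov_dyck_skew S l) (markov_dyck_skew S' l') ->
    G_conjugate (markov_dyck_pos_skew S l) (markov_dyck_pos_skew S' l'))
  /\
  (forall l1 l2 : dyck_symbol A -> gT,
    ~ G_conjugate (markov_dyck_pos_skew S l1) (markov_dyck_pos_skew S l2) ->
    ~ G_conjugate (markov_dyck_skew S l1) (markov_dyck_skew S l2)).
Proof.
split=> [l N' A' hA' hcol' O' S' hS' l'|l1 l2 npos conj].
  exact: markov_dyck_skew_pos.
by apply: npos; apply: markov_dyck_skew_pos conj.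
Qed.
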